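(* Let $X$ be a topological space, let $\mathcal{G}$ be a sheaf of not necessarily abelian groups over $X$, let $\Psi\in H^1(X,\mathcal{G})$, and let $\mathcal{U}=(U_i)_{i\in I}$ be an open covering of $X$. If $\Psi|_{U_n}=1$ for all $n\in I$, then there exists $\Phi\in H^1(\mathcal{U},\mathcal{G})$ with $[\Phi]=\Psi$.
   Context: A sheaf of not necessarily abelian groups over $X$ is a triple $\mathcal{G}=(S,\pi,X)$ where $S$ is a topological space, $\pi:S\to X$ is a continuous surjection, every $s\in S$ has an open neighbourhood $N\subset S$ such that $\pi|_N$ is a homeomorphism onto an open subset $\pi(N)$ of $X$, every stalk $\mathcal{G}_x=\pi^{-1}(x)$ is a group, and $(s,t)\mapsto st^{-1}$ is continuous on $\{(s,t)\in S\times S: \pi(s)=\pi(t)\}$. For $U\subset X$ open, $\mathcal{G}(U)$ is the group (under pointwise multiplication) of sections over $U$, i.e. continuous $f:U\to S$ with $\pi\circ f=\mathrm{id}_U$; $1$ denotes the section $x\mapsto 1_x$, and $f^{-1}$ the pointwise inverse. For an open covering $\mathcal{U}=(U_i)_{i\in I}$ of $X$ write $U_{ij}=U_i\cap U_j$, $U_{ijk}=U_i\cap U_j\cap U_k$. $\mathcal{C}^0(\mathcal{U},\mathcal{G})$ is the set of families $(h_i)_{i\in I}$ with $h_i\in\mathcal{G}(U_i)$. $\mathcal{Z}^1(\mathcal{U},\mathcal{G})$ is the set of 1-cocycles, i.e. families $(f_{ij})_{i,j\in I}$ with $f_{ij}\in\mathcal{G}(U_{ij})$ and $f_{ij}f_{jk}=f_{ik}$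 on $U_{ijk}$ for all $i,j,k$. Two 1-cocycles $f,g$ are equivalent if there is $h\in\mathcal{C}^0(\mathcal{U},\mathcal{G})$ with $g_{ij}=h_i^{-1}f_{ij}h_j$ on $U_{ij}$ for all $i,j$. $H^1(\mathcal{U},\mathcal{G})$ is the set of equivalence classes $[f]$; $1\in H^1(\mathcal{U},\mathcal{G})$ is the class of the cocycles of the form $f_{ij}=h_i^{-1}h_j$. An open covering $\mathcal{V}=(V_j)_{j\in J}$ of $X$ is a refinement of $\mathcal{U}$ if there is $\varphi:J\to I$ with $V_j\subset U_{\varphi j}$ for all $j$. Then $(\varphi^*f)_{ij}=f_{\varphi i,\varphi j}|_{V_{ij}}$ induces a map $\varphi^{\mathcal{U}}_{\mathcal{V}}:H^1(\mathcal{U},\mathcal{G})\to H^1(\mathcal{V},\mathcal{G})$, which is independent of the choice of $\varphi$. Elements $\Phi_1\in H^1(\mathcal{U},\mathcal{G})$ and $\Phi_2\in H^1(\mathcal{V},\mathcal{G})$ (for open coverings $\mathcal{U},\mathcal{V}$ of $X$) are equivalent if there is a common refinement $\mathcal{W}$ of $\mathcal{U}$ and $\mathcal{V}$ with $\varphi^{\mathcal{U}}_{\mathcal{W}}\Phi_1=\varphi^{\mathcal{V}}_{\mathcal{W}}\Phi_2$. $H^1(X,\mathcal{G})$ is the set of equivalence classes of the disjoint union of all $H^1(\mathcal{U},\mathcal{G})$, $\mathcal{U}$ running over all open coverings of $X$ (with index sets taken inside a fixed sufficiently large set). The class of $\Phi\in H^1(\mathcal{U},\mathcal{G})$ in $H^1(X,\mathcal{G})$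 is denoted $[\Phi]$; the common class of all the elements $1$ is denoted $1$. Restriction to an open $Y\subset X$: for $f\in\mathcal{Z}^1(\mathcal{U},\mathcal{G})$, $f|_Y=(f_{ij}|_{U_{ij}\cap Y})_{i,j}$ is a 1-cocycle for the covering $\mathcal{U}|_Y=(U_i\cap Y)_{i\in I}$ of $Y$; for $\Phi=[f]$ put $\Phi|_Y=[f|_Y]\in H^1(\mathcal{U}|_Y,\mathcal{G})$; for $\Psi=[\Phi]\in H^1(X,\mathcal{G})$ put $\Psi|_Y=[\Phi|_Y]\in H^1(Y,\mathcal{G})$. These are well defined. *)

(* Defs.v *)
From HB Require Import structures.
From mathcomp Require Import all_boot.
From mathcomp Require Import all_classical.
From mathcomp Require Import topology_structure initial_topology.
From mathcomp Require Import product_topology subspace_topology.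
From mathcomp Require Import subtype_topology.
From Corelib Require Import RelationClasses.

Set Implicit Arguments.
Unset Strict Implicit.
Unset Printing Implicit Defensive.

Local Open Scope classical_set_scope.
Local Open Scope group_scope.

(* [sig], [sigT] and [set] are avoided in the quotients and in [H1_total] below:
   their universes are bounded by those of the carriers of topological spaces,
   which would forbid coverings indexed by large sets. *)
Record quotient_set (T : Type) (R : T -> T -> Prop) : Type := QuotientSet {
  quotient_mem :> T -> Prop;
  quotient_memP : exists t, quotient_mem = R t
}.

Definition eq_class (T : Type) (R : T -> T -> Prop) (t : T) : quotient_set R :=
  QuotientSet (ex_intro _ t erefl).

Lemma pred_ext (T : Type) (P Q : T -> Prop) : (forall t, P t <-> Q t) -> P = Q.
Proof. by move=> PQ; apply: functional_extensionality_dep => t; exact: propext. Qed.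

Lemma quotient_ext (T : Type) (R : T -> T -> Prop) (p q : quotient_set R) :
  (forall t, p t <-> q t) -> p = q.
Proof.
case: p q => P hP [Q hQ] /= /pred_ext E; case: _ / E hQ => hQ.
by congr QuotientSet; exact: Prop_irrelevance.
Qed.

Lemma quotient_ind (T : Type) (R : T -> T -> Prop) (q : quotient_set R) :
  exists t, q = eq_class R t.
Proof.
by case: q => C [t Ct]; exists t; apply: quotient_ext => u /=; rewrite Ct.
Qed.

Lemma eq_class_eq (T : Type) (R : T -> T -> Prop) (eqR : Equivalence R) t u :
  eq_class R t = eq_class R u <-> R t u.
Proof.
case: eqR => rR sR tR; split=> [E|tu].
  by change (eq_class R t u); rewrite E; exact: rR.
apply: quotient_ext => v /=; split=> h; last exact: tR h.
by apply: tR h; exact: sR.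
Qed.

Section quotient_map.
Variables (T T' : Type) (R : T -> T -> Prop) (R' : T' -> T' -> Prop).
Variables (eqR : Equivalence R) (eqR' : Equivalence R') (f : T -> T').
Hypothesis fR : forall t u, R t u -> R' (f t) (f u).

Lemma quotient_map_subproof (q : quotient_set R) :
  exists t', (fun u' => exists2 t, q t & R' (f t) u') = R' t'.
Proof.
case: (quotient_ind q) => t ->; exists (f t); apply: pred_ext => u' /=.
split=> [[u tu h]|h]; last by exists t => //; case: eqR.
by case: eqR' => _ _ tR'; apply: tR' h; exact: fR.
Qed.

(* The map induced by [f] on equivalence classes: the class of [t] is sent to
   the class of [f t], see [quotient_mapE]. *)
Definition quotient_map (q : quotient_set R) : quotient_set R' :=
  QuotientSet (quotient_map_subproof q).

Lemma quotient_mapE t : quotient_map (eq_class R t) = eq_class R' (f t).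
Proof.
apply: quotient_ext => u' /=.
split=> [[u tu h]|h]; last by exists t => //; case: eqR.
by case: eqR' => _ _ tR'; apply: tR' h; exact: fR.
Qed.

End quotient_map.

Definition homeo_on (S T : topologicalType) (N : set S) (p : S -> T) : Prop :=
  {within N, continuous p} /\
  exists q : T -> S,
    {within p @` N, continuous q} /\ (forall s, N s -> q (p s) = s).

Record etale_space (X : topologicalType) := EtaleSpace {
  total_space :> topologicalType;
  proj : total_space -> X;
  proj_continuous : continuous proj;
  proj_surj : forall x, exists s, proj s = x;
  proj_local_homeo : forall s, exists N : set total_space,
    [/\ open N, N s, open (proj @` N) & homeo_on N proj]
}.
Arguments proj {X e} s.

Section stalks.
Variables (X : topologicalType) (E : etale_space X).

Definition stalk_type (x : X) : Type := {s : E | proj s = x}.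

Definition fibre_square : set (E * E) := [set p | proj p.1 = proj p.2].

(* The map (s, t) |-> s t^-1, computed in the stalk at [proj t] (which is also
   the stalk at [proj s]). *)
Definition fibre_div (grp : forall x, Group (stalk_type x))
    (p : fibre_square) : E :=
  let s : Group.Pack (grp (proj (val p).2)) :=
    exist _ (val p).1 (set_valP p) in
  let t : Group.Pack (grp (proj (val p).2)) :=
    exist _ (val p).2 erefl in
  sval (s / t).

End stalks.
Arguments fibre_square {X} E.

Record group_sheaf (X : topologicalType) := GroupSheaf {
  sheaf_etale :> etale_space X;
  stalk_group : forall x, Group (stalk_type sheaf_etale x);
  stalk_div_continuous : continuous (fibre_div stalk_group)
}.

Definition stalk (X : topologicalType) (G : group_sheaf X) (x : X)
  : groupType := Group.Pack (stalk_group G x).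

Section sections.
Variables (X : topologicalType) (G : group_sheaf X).

Lemma stalk_ext x (s t : stalk G x) : sval s = sval t -> s = t.
Proof. exact: eq_sig_hprop. Qed.

Record section (U : set X) := Section {
  section_fun :> U -> G;
  section_continuous : continuous section_fun;
  section_proj : forall x : U, proj (section_fun x) = val x
}.

Definition sec_at (U : set X) (f : section U) (x : X) (Ux : U x) : stalk G x :=
  exist _ (f (SigSub (mem_set Ux))) (section_proj f (SigSub (mem_set Ux))).

Lemma sec_at_irr (U : set X) (f : section U) x (Ux Ux' : U x) :
  sec_at f Ux = sec_at f Ux'.
Proof. by rewrite (Prop_irrelevance Ux Ux'). Qed.

Lemma section_ext (U : set X) (f g : section U) :
  (forall x (Ux : U x), sec_at f Ux = sec_at g Ux) -> f = g.
Proof.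
case: f g => [f cf pf] [g cg pg] fg.
have E : f = g.
  apply: funext => -[x Ux].
  have /(congr1 sval)/= := fg x (set_mem Ux).
  by rewrite (Prop_irrelevance (mem_set (set_mem Ux)) Ux).
by case: _ / E in cg pg fg *; congr Section; exact: Prop_irrelevance.
Qed.

Lemma stalk_div_cast (s t : G) x (es : proj s = x) (et : proj t = x)
    (p : fibre_square G) : val p = (s, t) ->
  fibre_div (stalk_group G) p =
  sval ((exist _ s es : stalk G x) / (exist _ t et : stalk G x)).
Proof.
case: p => -[s' t'] /= p [ss tt]; subst s' t'; case: _ / et es => es.
by rewrite (Prop_irrelevance es (set_valP (exist _ (s, t) p : fibre_square G))).
Qed.

Lemma fibre_div_continuous (Y : topologicalType) (a b : Y -> G) (c : Y -> X)
    (ea : forall y, proj (a y) = c y) (eb : forall y, proj (b y) = c y) :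
  continuous a -> continuous b ->
  continuous (fun y => sval ((exist _ (a y) (ea y) : stalk G (c y)) /
                             (exist _ (b y) (eb y) : stalk G (c y)))).
Proof.
move=> ca cb.
have m y : (a y, b y) \in fibre_square G by apply: mem_set; rewrite /fibre_square /= ea eb.
pose k (y : Y) : fibre_square G := exist _ (a y, b y) (m y).
have ck : continuous k.
  apply: continuous_comp_initial => y.
  rewrite (_ : set_val \o k = fun y => (a y, b y)); last first.
    by apply: funext => z; rewrite set_valE.
  by apply: cvg_pair; [exact: ca|exact: cb].
rewrite (_ : (fun y => _) = fibre_div (stalk_group G) \o k); last first.
  by apply: funext => y /=; rewrite (@stalk_div_cast (a y) (b y) _ (ea y) (eb y)).
move=> y; apply: continuous_comp; first exact: ck.
exact: stalk_div_continuous.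
Qed.

Lemma unit_continuous : continuous (fun x => sval (1 : stalk G x) : G).
Proof.
move=> x0; have [s sx0] := proj_surj G x0.
have [N [oN Ns oP [_ [q [cq qK]]]]] := proj_local_homeo s.
set V := proj @` N in oP cq.
have Vx0 : V x0 by exists s.
suff /subspace_sigL_continuousP : continuous
    (sigL V (fun x => sval (1 : stalk G x) : G)).
  by rewrite continuous_open_subspace// => /(_ x0 (mem_set Vx0)).
have e (y : V) : proj (q (val y)) = val y.
  by case: y => y /= /set_mem[t Nt <-]; rewrite qK.
have cqV : continuous (fun y : V => q (val y)).
  by move/subspace_sigL_continuousP : cq; rewrite /sigL set_valE.
have := fibre_div_continuous (ea := e) (eb := e) cqV cqV.
rewrite (_ : (fun y => _) = sigL V (fun x => sval (1 : stalk G x) : G))//.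
by apply: funext => y; rewrite mulgV /sigL /= set_valE.
Qed.

Definition sec_one (U : set X) : section U.
Proof.
refine (@Section U (fun x => sval (1 : stalk G (val x))) _ _).
  move=> x; apply: (@continuous_comp _ _ _ (val : U -> X)
    (fun x => sval (1 : stalk G x) : G)); last exact: unit_continuous.
  by have := @initial_continuous _ _ (set_val : U -> X); rewrite set_valE; apply.
by move=> x; exact: (svalP (1 : stalk G (val x))).
Defined.

Definition sec_div (U : set X) (f g : section U) : section U :=
  @Section U
    (fun x => sval ((exist _ (f x) (section_proj f x) : stalk G (val x)) /
                    (exist _ (g x) (section_proj g x) : stalk G (val x))))
    (fibre_div_continuous (@section_continuous _ f) (@section_continuous _ g))
    (fun x => svalP ((exist _ (f x) (section_proj f x) : stalk G (val x)) /
                    (exist _ (g x) (section_proj g x) : stalk G (val x)))).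

Definition sec_inv (U : set X) (f : section U) := sec_div (sec_one U) f.
Definition sec_mul (U : set X) (f g : section U) := sec_div f (sec_inv g).

Lemma sec_at1 (U : set X) x (Ux : U x) : sec_at (sec_one U) Ux = 1.
Proof. exact: stalk_ext. Qed.

Lemma sec_atF (U : set X) (f g : section U) x (Ux : U x) :
  sec_at (sec_div f g) Ux = sec_at f Ux / sec_at g Ux.
Proof. exact: stalk_ext. Qed.

Lemma sec_atV (U : set X) (f : section U) x (Ux : U x) :
  sec_at (sec_inv f) Ux = (sec_at f Ux)^-1.
Proof. by rewrite sec_atF sec_at1 mul1g. Qed.

Lemma sec_atM (U : set X) (f g : section U) x (Ux : U x) :
  sec_at (sec_mul f g) Ux = sec_at f Ux * sec_at g Ux.
Proof. by rewrite sec_atF sec_atV invgK. Qed.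

Definition incl (U V : set X) (UV : U `<=` V) (x : U) : V :=
  SigSub (mem_set (UV _ (set_valP x))).

Lemma incl_continuous (U V : set X) (UV : U `<=` V) : continuous (incl UV).
Proof.
apply: continuous_comp_initial => x.
rewrite (_ : set_val \o _ = set_val); last by apply: funext => y; rewrite set_valE.
exact: initial_continuous.
Qed.

Definition sec_res (U V : set X) (UV : U `<=` V) (f : section V) : section U.
Proof.
refine (@Section U (f \o incl UV) _ _).
  move=> x; apply: continuous_comp; first exact: incl_continuous.
  exact: section_continuous.
by move=> x /=; rewrite section_proj.
Defined.

Lemma sec_at_res (U V : set X) (UV : U `<=` V) (f : section V) x (Ux : U x) :
  sec_at (sec_res UV f) Ux = sec_at f (UV _ Ux).
Proof.
apply: stalk_ext => /=; congr (section_fun f _); rewrite /incl.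
by apply: val_inj.
Qed.

End sections.

(* Open coverings of an open subset [Y] of [X] by open subsets of [X]; the
   coverings of the whole space are those of [[set: X]].  The universe of
   [cover_index] plays the role of the fixed large set of indices. *)
Record open_cover (X : topologicalType) (Y : set X) := OpenCover {
  cover_index : Type;
  cover_dom :> cover_index -> set X;
  cover_open : forall i, open (cover_dom i);
  cover_eq : \bigcup_i cover_dom i = Y
}.

Section covers.
Variables (X : topologicalType).

Definition refines_by (Y : set X) (V U : open_cover Y)
  (phi : cover_index V -> cover_index U) : Prop :=
  forall j, V j `<=` U (phi j).

Definition restrict_cover (Y : set X) (oY : open Y)
  (U : open_cover [set: X]) : open_cover Y.
Proof.
refine (@OpenCover X Y (cover_index U) (fun i => U i `&` Y) _ _).
  by move=> i; apply: openI => //; exact: cover_open.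
by rewrite -setI_bigcupl cover_eq setTI.
Defined.

Definition trivial_cover (Y : set X) (oY : open Y) : open_cover Y.
Proof.
by refine (@OpenCover X Y unit (fun=> Y) (fun=> oY) _); apply: bigcup_const; exists tt.
Defined.

(* Every open subset of [Y] is a member of this covering; its index set forces
   the universe of [cover_index] to contain the subsets of [X]. *)
Definition all_opens_cover (Y : set X) (oY : open Y) : open_cover Y.
Proof.
refine (@OpenCover X Y (set X) (fun A => A^° `&` Y) _ _).
  by move=> A; apply: openI => //; exact: open_interior.
by apply/seteqP; split=> [x [A _ []]//|x Yx]; exists setT => //; rewrite interiorT.
Defined.

Definition meet_cover (Y : set X) (U V : open_cover Y) : open_cover Y.
Proof.
refine (@OpenCover X Y (cover_index U * cover_index V)%type
  (fun ij => U ij.1 `&` V ij.2) _ _).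
  by move=> ij; apply: openI; exact: cover_open.
apply/seteqP; split=> [x [ij _ [Ux _]]|x Yx].
  by rewrite -(cover_eq U); exists ij.1.
have [i _ Ux] : (\bigcup_i U i) x by rewrite cover_eq.
have [j _ Vx] : (\bigcup_i V i) x by rewrite cover_eq.
by exists (i, j).
Defined.

End covers.

Section cech.
Variables (X : topologicalType) (G : group_sheaf X).

Definition cochain0 (Y : set X) (U : open_cover Y) : Type :=
  forall i, section G (U i).

Record cocycle (Y : set X) (U : open_cover Y) := Cocycle {
  cocycle_fun :> forall i j, section G (U i `&` U j);
  cocycleP : forall i j k x (xi : U i x) (xj : U j x) (xk : U k x),
    sec_at (cocycle_fun i j) (conj xi xj) *
    sec_at (cocycle_fun j k) (conj xj xk) =
    sec_at (cocycle_fun i k) (conj xi xk)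
}.

Definition cohomologous (Y : set X) (U : open_cover Y) (f g : cocycle U)
  : Prop :=
  exists h : cochain0 U, forall i j x (xi : U i x) (xj : U j x),
    sec_at (g i j) (conj xi xj) =
    (sec_at (h i) xi)^-1 * sec_at (f i j) (conj xi xj) * sec_at (h j) xj.

Lemma cohomologous_equiv (Y : set X) (U : open_cover Y) :
  Equivalence (@cohomologous Y U).
Proof.
split.
- move=> f; exists (fun i => sec_one G (U i)) => i j x xi xj.
  by rewrite !sec_at1 invg1 mul1g mulg1.
- move=> f g [h hE]; exists (fun i => sec_inv (h i)) => i j x xi xj.
  by rewrite !sec_atV hE invgK !mulgA mulgV mul1g mulgK.
- move=> f g k [h hE] [h' hE']; exists (fun i => sec_mul (h i) (h' i)).
  by move=> i j x xi xj; rewrite !sec_atM hE' hE invgM !mulgA.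
Qed.

Definition H1_cover (Y : set X) (U : open_cover Y) : Type :=
  quotient_set (@cohomologous Y U).

Definition H1_cocycle (Y : set X) (U : open_cover Y) (f : cocycle U)
  : H1_cover U := eq_class (@cohomologous Y U) f.

Lemma H1_cocycle_eq (Y : set X) (U : open_cover Y) (f g : cocycle U) :
  H1_cocycle f = H1_cocycle g <-> cohomologous f g.
Proof. exact: eq_class_eq (cohomologous_equiv U) f g. Qed.

Definition cocycle_one (Y : set X) (U : open_cover Y) : cocycle U.
Proof.
refine (@Cocycle Y U (fun i j => sec_one G (U i `&` U j)) _).
by move=> i j k x xi xj xk; rewrite !sec_at1 mulg1.
Defined.

Definition H1_cover_one (Y : set X) (U : open_cover Y) : H1_cover U :=
  H1_cocycle (cocycle_one U).

Lemma H1_cover_oneP (Y : set X) (U : open_cover Y) (f : cocycle U) :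
  H1_cocycle f = H1_cover_one U <->
  exists h : cochain0 U, forall i j x (xi : U i x) (xj : U j x),
    sec_at (f i j) (conj xi xj) = (sec_at (h i) xi)^-1 * sec_at (h j) xj.
Proof.
split=> [/esym/H1_cocycle_eq[h hE]|[h hE]].
  by exists h => i j x xi xj; rewrite hE sec_at1 mulg1.
by apply/esym/H1_cocycle_eq; exists h => i j x xi xj; rewrite hE sec_at1 mulg1.
Qed.

Lemma cocycle_diag (Y : set X) (U : open_cover Y) (f : cocycle U) i x
  (xi xi' : U i x) : sec_at (f i i) (conj xi xi') = 1.
Proof.
rewrite (Prop_irrelevance xi' xi).
by apply: (mulgI (sec_at (f i i) (conj xi xi))); rewrite cocycleP mulg1.
Qed.

Definition cocycle_pull (Y : set X) (U V : open_cover Y)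
    (phi : cover_index V -> cover_index U) (ref : refines_by phi)
    (f : cocycle U) : cocycle V.
Proof.
refine (@Cocycle Y V
  (fun i j => sec_res (setISS (ref i) (ref j)) (f (phi i) (phi j))) _).
move=> i j k x xi xj xk; rewrite !sec_at_res.
rewrite (sec_at_irr _ _ (conj (ref i x xi) (ref j x xj))).
rewrite (sec_at_irr _ _ (conj (ref j x xj) (ref k x xk))).
by rewrite (sec_at_irr _ _ (conj (ref i x xi) (ref k x xk))) cocycleP.
Defined.

Lemma cocycle_pullE (Y : set X) (U V : open_cover Y) phi
    (ref : @refines_by X Y V U phi) (f : cocycle U) i j x
    (xi : V i x) (xj : V j x) :
  sec_at (cocycle_pull ref f i j) (conj xi xj) =
  sec_at (f (phi i) (phi j)) (conj (ref i x xi) (ref j x xj)).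
Proof. by rewrite sec_at_res; exact: sec_at_irr. Qed.

Lemma cocycle_pull_cohomologous (Y : set X) (U V : open_cover Y) phi
    (ref : @refines_by X Y V U phi) (f g : cocycle U) :
  cohomologous f g -> cohomologous (cocycle_pull ref f) (cocycle_pull ref g).
Proof.
move=> [h hE]; exists (fun i => sec_res (ref i) (h (phi i))) => i j x xi xj.
by rewrite !cocycle_pullE hE !sec_at_res.
Qed.

Definition H1_pull (Y : set X) (U V : open_cover Y)
    (phi : cover_index V -> cover_index U) (ref : refines_by phi)
  : H1_cover U -> H1_cover V :=
  quotient_map (cohomologous_equiv U) (cohomologous_equiv V)
    (cocycle_pull_cohomologous ref).

Lemma H1_pullE (Y : set X) (U V : open_cover Y) phi
    (ref : @refines_by X Y V U phi) (f : cocycle U) :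
  H1_pull ref (H1_cocycle f) = H1_cocycle (cocycle_pull ref f).
Proof. exact: quotient_mapE. Qed.

(* The refinement map depends only on the two coverings. *)
Lemma H1_pull_irr (Y : set X) (U V : open_cover Y) phi psi
    (rphi : @refines_by X Y V U phi) (rpsi : @refines_by X Y V U psi) :
  H1_pull rphi = H1_pull rpsi.
Proof.
apply: funext => F; have [f ->] := quotient_ind F.
rewrite -/(H1_cocycle f) !H1_pullE; apply/H1_cocycle_eq.
have s i : V i `<=` U (phi i) `&` U (psi i).
  by move=> x xi; split; [exact: rphi|exact: rpsi].
exists (fun i => sec_res (s i) (f (phi i) (psi i))) => i j x xi xj.
rewrite !cocycle_pullE !sec_at_res.
rewrite (sec_at_irr _ (s i x xi) (conj (rphi i x xi) (rpsi i x xi))).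
rewrite (sec_at_irr _ (s j x xj) (conj (rphi j x xj) (rpsi j x xj))).
rewrite -mulgA cocycleP.
by rewrite -(cocycleP f (rphi i x xi) (rpsi i x xi) (rpsi j x xj)) mulKg.
Qed.

Lemma H1_pull_comp (Y : set X) (U V W : open_cover Y) phi psi
    (rphi : @refines_by X Y V U phi) (rpsi : @refines_by X Y W V psi)
    (r : @refines_by X Y W U (phi \o psi)) F :
  H1_pull rpsi (H1_pull rphi F) = H1_pull r F.
Proof.
have [f ->] := quotient_ind F; rewrite -/(H1_cocycle f) !H1_pullE.
apply/H1_cocycle_eq; exists (fun i => sec_one G (W i)) => i j x xi xj.
rewrite !sec_at1 invg1 mul1g mulg1 !cocycle_pullE.
exact: sec_at_irr.
Qed.

Lemma H1_pull_one (Y : set X) (U V : open_cover Y) phi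
    (ref : @refines_by X Y V U phi) :
  H1_pull ref (H1_cover_one U) = H1_cover_one V.
Proof.
rewrite H1_pullE; apply/H1_cocycle_eq.
exists (fun i => sec_one G (V i)) => i j x xi xj.
by rewrite cocycle_pullE !sec_at1 invg1 !mulg1.
Qed.

Record H1_total (Y : set X) : Type := InTotal {
  total_cover : open_cover Y;
  total_class : H1_cover total_cover
}.

(* The refinement maps are given by arbitrary index maps [phi], [psi]; by
   [H1_pull_irr] these choices are immaterial. *)
Definition H1_equiv (Y : set X) (F1 F2 : H1_total Y) : Prop :=
  exists (W : open_cover Y)
    (phi : cover_index W -> cover_index (total_cover F1))
    (psi : cover_index W -> cover_index (total_cover F2))
    (rphi : refines_by phi) (rpsi : refines_by psi),
    H1_pull rphi (total_class F1) = H1_pull rpsi (total_class F2).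

Lemma H1_equiv_equiv (Y : set X) : Equivalence (@H1_equiv Y).
Proof.
split.
- by move=> [U F]; exists U, id, id, (fun i => @subset_refl _ (U i)),
    (fun i => @subset_refl _ (U i)).
- by move=> F1 F2 [W [phi [psi [rphi [rpsi E]]]]]; exists W, psi, phi, rpsi, rphi.
- move=> F1 F2 F3 [W [phi [psi [rphi [rpsi E]]]]].
  move=> [W' [phi' [psi' [rphi' [rpsi' E']]]]].
  have r1 : @refines_by X Y (meet_cover W W') W fst by move=> i x [].
  have r2 : @refines_by X Y (meet_cover W W') W' snd by move=> i x [].
  have s1 : @refines_by X Y (meet_cover W W') (total_cover F1) (phi \o fst).
    by move=> i x /r1/rphi.
  have s2 : @refines_by X Y (meet_cover W W') (total_cover F2) (psi \o fst).
    by move=> i x /r1/rpsi.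
  have s2' : @refines_by X Y (meet_cover W W') (total_cover F2) (phi' \o snd).
    by move=> i x /r2/rphi'.
  have s3 : @refines_by X Y (meet_cover W W') (total_cover F3) (psi' \o snd).
    by move=> i x /r2/rpsi'.
  exists (meet_cover W W'), (phi \o fst), (psi' \o snd), s1, s3.
  rewrite -(H1_pull_comp rphi r1) E (H1_pull_comp rpsi r1 s2).
  by rewrite (H1_pull_irr s2 s2') -(H1_pull_comp rphi' r2) E' (H1_pull_comp _ _ s3).
Qed.

(* As the opens of an open set [Y] are the opens of [X] contained in [Y],
   [H1 Y] is the cohomology set of [Y] with coefficients in the restriction of
   [G] to [Y]; the cohomology set of the whole space is [H1 [set: X]]. *)
Definition H1 (Y : set X) : Type := quotient_set (@H1_equiv Y).

Definition H1_class (Y : set X) (U : open_cover Y) (F : H1_cover U) : H1 Y :=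
  eq_class (@H1_equiv Y) (InTotal F).

(* The class of the element 1 of any open covering of [Y], see [H1_oneE]; the
   one-element covering {Y} is used here. *)
Definition H1_one (Y : set X) (oY : open Y) : H1 Y :=
  H1_class (H1_cover_one (trivial_cover oY)).

Lemma H1_oneE (Y : set X) (oY : open Y) (U : open_cover Y) :
  H1_class (H1_cover_one U) = H1_one oY.
Proof.
apply/(eq_class_eq (H1_equiv_equiv Y)).
have r : @refines_by X Y U (trivial_cover oY) (fun=> tt).
  by move=> i x Ux /=; rewrite -(cover_eq U); exists i.
exists U, id, (fun=> tt), (fun i => @subset_refl _ (U i)), r.
by rewrite !H1_pull_one.
Qed.

Section restriction.
Variables (Y : set X) (oY : open Y).

Definition cocycle_restrict (U : open_cover [set: X]) (f : cocycle U)
  : cocycle (restrict_cover oY U).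
Proof.
refine (@Cocycle Y (restrict_cover oY U)
  (fun i j => sec_res (setISS (@subIsetl _ (U i) Y) (@subIsetl _ (U j) Y))
                (f i j)) _).
move=> i j k x [xi xY] [xj xY'] [xk xY'']; rewrite !sec_at_res.
rewrite (sec_at_irr _ _ (conj xi xj)) (sec_at_irr _ _ (conj xj xk)).
by rewrite (sec_at_irr _ _ (conj xi xk)) cocycleP.
Defined.

Lemma cocycle_restrictE (U : open_cover [set: X]) (f : cocycle U) i j x
    (xi : U i x) (xj : U j x) (yi yj : Y x) :
  sec_at (cocycle_restrict f i j) (conj (conj xi yi) (conj xj yj)) =
  sec_at (f i j) (conj xi xj).
Proof. by rewrite sec_at_res; exact: sec_at_irr. Qed.

Lemma cocycle_restrict_cohomologous (U : open_cover [set: X])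
    (f g : cocycle U) :
  cohomologous f g -> cohomologous (cocycle_restrict f) (cocycle_restrict g).
Proof.
move=> [h hE]; exists (fun i => sec_res (@subIsetl _ (U i) Y) (h i)).
move=> i j x [xi yi] [xj yj]; rewrite !cocycle_restrictE hE !sec_at_res.
by congr (_^-1 * _ * _); exact: sec_at_irr.
Qed.

Definition H1_cover_restrict (U : open_cover [set: X])
  : H1_cover U -> H1_cover (restrict_cover oY U) :=
  quotient_map (cohomologous_equiv U)
    (cohomologous_equiv (restrict_cover oY U))
    (@cocycle_restrict_cohomologous U).

Lemma H1_cover_restrictE (U : open_cover [set: X]) (f : cocycle U) :
  H1_cover_restrict (H1_cocycle f) = H1_cocycle (cocycle_restrict f).
Proof. exact: quotient_mapE. Qed.

Definition H1_total_restrict (F : H1_total [set: X]) : H1_total Y :=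
  InTotal (H1_cover_restrict (total_class F)).

Lemma H1_restrict_pull (U V : open_cover [set: X]) phi
    (ref : @refines_by X [set: X] V U phi)
    (ref' : @refines_by X Y (restrict_cover oY V) (restrict_cover oY U) phi) F :
  H1_pull ref' (H1_cover_restrict F) = H1_cover_restrict (H1_pull ref F).
Proof.
have [f ->] := quotient_ind F; rewrite -/(H1_cocycle f).
rewrite H1_cover_restrictE !H1_pullE H1_cover_restrictE.
apply/H1_cocycle_eq; exists (fun i => sec_one G _) => i j x [xi yi] [xj yj].
rewrite !sec_at1 invg1 mul1g mulg1 cocycle_restrictE !cocycle_pullE.
rewrite -(cocycle_restrictE f _ _ yi yj).
exact: sec_at_irr.
Qed.

Lemma H1_total_restrict_equiv (F1 F2 : H1_total [set: X]) :
  H1_equiv F1 F2 -> H1_equiv (H1_total_restrict F1) (H1_total_restrict F2).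
Proof.
move=> [W [phi [psi [rphi [rpsi E]]]]].
have sphi : @refines_by X Y (restrict_cover oY W)
    (restrict_cover oY (total_cover F1)) phi by move=> i; exact: setSI.
have spsi : @refines_by X Y (restrict_cover oY W)
    (restrict_cover oY (total_cover F2)) psi by move=> i; exact: setSI.
exists (restrict_cover oY W), phi, psi, sphi, spsi => /=.
by rewrite (H1_restrict_pull rphi) E (H1_restrict_pull rpsi).
Qed.

Definition H1_restrict : H1 [set: X] -> H1 Y :=
  quotient_map (H1_equiv_equiv [set: X]) (H1_equiv_equiv Y)
    H1_total_restrict_equiv.

Lemma H1_restrictE (U : open_cover [set: X]) (F : H1_cover U) :
  H1_restrict (H1_class F) = H1_class (H1_cover_restrict F).
Proof. exact: quotient_mapE. Qed.

End restriction.

End cech.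

Arguments cover_open {X Y} o i.
Arguments H1_cover {X} G {Y} U.
Arguments H1 {X} G Y.
Arguments H1_one {X} G {Y} oY.

(* Main.v *)
Require Import Defs.
From mathcomp Require Import all_boot.
From mathcomp Require Import all_classical.
From mathcomp Require Import topology_structure.
From mathcomp Require Import initial_topology subspace_topology.
From mathcomp Require Import subtype_topology.

(** Represent [Psi] by a cocycle [f] on some covering [V].  The first step is
    that a covering sees triviality faithfully: if the class of a cocycle in
    the cohomology set of an open set is 1, then the cocycle is already a
    coboundary on its own covering ([H1_class_eq_one]).  Applied to the
    restrictions of [f], this gives for each [n] sections [h n a] over the
    intersections of [V a] and [U n] such that [f a b = (h n a)^-1 * h n b] on
    [U n].  Over the common part of [U n] and [U m], the quotients
    [h n a / h m a] do not depend on [a], because [h n] and [h m] trivialize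
    the same [f]; they glue to a section [g n m] over [U n `&` U m], and these
    sections form a cocycle on [U].  On the covering by the intersections of
    the [U n] and the [V a], the identity [f a b = (h n a)^-1 * g n m * h m b]
    says that the [h n a] make [f] and [g] cohomologous, so [g] represents
    [Psi] ([cocycle_of_local_coboundaries]). *)

Local Open Scope classical_set_scope.

Section gluing.
Context {X : topologicalType} {G : group_sheaf X}.
Local Open Scope group_scope.

Lemma section_glue (U : set X) (I : Type) (D : I -> set X)
    (s : forall i, section G (D i)) :
  (forall i, open (D i)) -> \bigcup_i D i = U ->
  (forall i j x (xi : D i x) (xj : D j x),
    sec_at (s i) xi = sec_at (s j) xj) ->
  exists t : section G U, forall i x (xi : D i x) (xU : U x),
    sec_at t xU = sec_at (s i) xi.
Proof.
move=> oD DU compat.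
have val_ex x : exists y : stalk G x, forall i (xi : D i x), y = sec_at (s i) xi.
  have [[i xi]|nDx] := pselect (exists i, D i x).
    by exists (sec_at (s i) xi) => j xj; exact: compat.
  by exists 1 => i xi; case: nDx; exists i.
pose y x := proj1_sig (cid (val_ex x)).
have yE x i (xi : D i x) : y x = sec_at (s i) xi.
  exact: proj2_sig (cid (val_ex x)) i xi.
(* Outside the [D i], the value of [T] is the junk allowed by [val_ex];
   continuity is only claimed on [U]. *)
pose T x : G := sval (y x).
have cT x : U x -> {for x, continuous T}.
  rewrite -DU => -[i _ xi].
  suff /subspace_sigL_continuousP : continuous (sigL (D i) T).
    by rewrite continuous_open_subspace// => /(_ x (mem_set xi)).
  rewrite (_ : sigL (D i) T = s i); first exact: section_continuous.
  apply: funext => -[z zi]; rewrite /sigL /= set_valE /T /= (yE z i (set_mem zi)) /=.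
  by congr (section_fun (s i) _); apply: val_inj.
have ct : continuous (T \o (val : U -> X)).
  move=> z; apply: continuous_comp; last by apply: cT; exact: set_mem (valP z).
  by have := @initial_continuous _ _ (set_val : U -> X); rewrite set_valE; apply.
exists (Section ct (fun z => proj2_sig (y (val z)))) => i x xi xU.
by apply: stalk_ext; rewrite -yE.
Qed.

(** If [f] becomes a coboundary [(h i)^-1 * h j] on a refinement [W], its
    trivialization over [V a] can be recovered by transporting [h i] along
    [f (phi i) a]: the sections [h i * f (phi i) a] agree on overlaps by the
    cocycle relation, hence glue over all of [V a]. *)
Lemma H1_class_eq_one (Y : set X) (oY : open Y) (V : open_cover Y)
    (f : cocycle G V) :
  H1_class (H1_cocycle f) = H1_one G oY -> H1_cocycle f = H1_cover_one G V.
Proof.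
move=> /(eq_class_eq (H1_equiv_equiv G Y)) [W [phi [psi [rphi [rpsi]]]]] /=.
rewrite H1_pullE H1_pull_one => /H1_cover_oneP[h hE]; apply/H1_cover_oneP.
have {hE} fE i j x (xi : W i x) (xj : W j x) : sec_at (f (phi i) (phi j))
    (conj (rphi i x xi) (rphi j x xj)) = (sec_at (h i) xi)^-1 * sec_at (h j) xj.
  by rewrite -hE cocycle_pullE.
have loc a : exists k : section G (V a),
    forall i x (xa : V a x) (xi : W i x),
      sec_at k xa = sec_at (h i) xi * sec_at (f (phi i) a) (conj (rphi i x xi) xa).
  have sub i : V a `&` W i `<=` V (phi i) `&` V a.
    by move=> x [xa xi]; split=> //; exact: (rphi i).
  pose s i := sec_mul (sec_res (@subIsetr _ (V a) (W i)) (h i))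
                      (sec_res (sub i) (f (phi i) a)).
  have sE i x (xa : V a x) (xi : W i x) : sec_at (s i) (conj xa xi) =
      sec_at (h i) xi * sec_at (f (phi i) a) (conj (rphi i x xi) xa).
    by rewrite sec_atM !sec_at_res; congr (_ * _); exact: sec_at_irr.
  have [||i j x [xa xi] [xa' xj]|k kE] := @section_glue (V a) _ _ s.
  - by move=> i; apply: openI; exact: cover_open.
  - rewrite -setI_bigcupr cover_eq setIidl// => x xa.
    by rewrite -(cover_eq V); exists a.
  - rewrite !sE (Prop_irrelevance xa' xa).
    by rewrite -(cocycleP f (rphi i x xi) (rphi j x xj) xa) fE mulgA mulVKg.
  by exists k => i x xa xi; rewrite (kE i x (conj xa xi)) sE.
pose k a := proj1_sig (cid (loc a)).
have kE a := proj2_sig (cid (loc a)) : forall i x xa xi, sec_at (k a) xa = _.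
exists k => a b x xa xb.
have [i _ xi] : (\bigcup_i W i) x by rewrite cover_eq -(cover_eq V); exists a.
rewrite !(kE _ i x _ xi) -(cocycleP f (rphi i x xi) xa xb).
by rewrite [sec_at (h i) xi * (_ * _)]mulgA mulKg.
Qed.

(** The trivializations of [f] over [U n] and over [U m] differ by a left
    factor that is independent of the member of [V]; these transition factors
    are the cocycle on [U]. *)
Lemma cocycle_of_local_coboundaries (V U : open_cover [set: X]) (f : cocycle G V) :
  (forall n, H1_cocycle (cocycle_restrict (cover_open U n) f) =
             H1_cover_one G (restrict_cover (cover_open U n) V)) ->
  exists g : cocycle G U, H1_class (H1_cocycle g) = H1_class (H1_cocycle f).
Proof.
move=> f1.
have h_ex n : exists h : forall a, section G (V a `&` U n),
    forall a b x (xa : V a x) (xb : V b x) (xn : U n x),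
      sec_at (f a b) (conj xa xb) =
      (sec_at (h a) (conj xa xn))^-1 * sec_at (h b) (conj xb xn).
  have /H1_cover_oneP[h hE] := f1 n; exists h => a b x xa xb xn.
  by rewrite -hE cocycle_restrictE.
pose h n := proj1_sig (cid (h_ex n)).
have hE n := proj2_sig (cid (h_ex n)) : forall a b x xa xb xn, _ =
  (sec_at (h n a) (conj xa xn))^-1 * sec_at (h n b) (conj xb xn).
have g_ex (nm : cover_index U * cover_index U) :
    exists g : section G (U nm.1 `&` U nm.2),
    forall a x (xa : V a x) (xn : U nm.1 x) (xm : U nm.2 x),
      sec_at g (conj xn xm) =
      sec_at (h nm.1 a) (conj xa xn) / sec_at (h nm.2 a) (conj xa xm).
  case: nm => n m /=.
  have subn a : V a `&` (U n `&` U m) `<=` V a `&` U n by move=> x [? []].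
  have subm a : V a `&` (U n `&` U m) `<=` V a `&` U m by move=> x [? []].
  pose s a := sec_div (sec_res (subn a) (h n a)) (sec_res (subm a) (h m a)).
  have sE a x (xa : V a x) (xn : U n x) (xm : U m x) :
      sec_at (s a) (conj xa (conj xn xm)) =
      sec_at (h n a) (conj xa xn) / sec_at (h m a) (conj xa xm).
    by rewrite sec_atF !sec_at_res; congr (_ / _); exact: sec_at_irr.
  have [||a b x [xa [xn xm]] [xb [xn' xm']]|g gE] :=
      @section_glue (U n `&` U m) _ _ s.
  - by move=> a; do 2?apply: openI; exact: cover_open.
  - by rewrite -setI_bigcupl cover_eq setTI.
  (* Both [h n] and [h m] split the same value of [f a b]. *)
  - rewrite (Prop_irrelevance xn' xn) (Prop_irrelevance xm' xm) !sE.
    have := hE n a b x xa xb xn; rewrite (hE m a b x xa xb xm).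
    by move=> /(canLR (mulVKg _)) <-; rewrite !mulgA mulgK.
  by exists g => a x xa xn xm; rewrite (gE a x (conj xa (conj xn xm))) sE.
pose g nm := proj1_sig (cid (g_ex nm)).
have gE nm := proj2_sig (cid (g_ex nm)) : forall a x xa xn xm,
  sec_at (g nm) (conj xn xm) = _.
have gP n m l x (xn : U n x) (xm : U m x) (xl : U l x) :
    sec_at (g (n, m)) (conj xn xm) * sec_at (g (m, l)) (conj xm xl) =
    sec_at (g (n, l)) (conj xn xl).
  have [a _ xa] : (\bigcup_a V a) x by rewrite cover_eq.
  by rewrite !(gE (_, _) a x xa) /= mulgA divgK.
exists (Cocycle (cocycle_fun := fun n m => g (n, m)) gP).
apply/(eq_class_eq (H1_equiv_equiv G _)).
have rU : @refines_by X _ (meet_cover U V) U fst by move=> i x [].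
have rV : @refines_by X _ (meet_cover U V) V snd by move=> i x [].
exists (meet_cover U V), fst, snd, rU, rV => /=.
rewrite !H1_pullE; apply/H1_cocycle_eq.
have sw (na : cover_index (meet_cover U V)) :
  meet_cover U V na `<=` V na.2 `&` U na.1 by move=> x [].
exists (fun na => sec_res (sw na) (h na.1 na.2)).
move=> -[n a] [m b] x [xn xa] [xm xb].
rewrite !cocycle_pullE !sec_at_res /=.
rewrite (sec_at_irr _ _ (conj xa xb)) (hE m a b x xa xb xm).
rewrite (sec_at_irr (g (n, m)) _ (conj xn xm)) (gE (n, m) a x xa) /=.
rewrite (sec_at_irr (h n a) _ (conj xa xn)).
rewrite (sec_at_irr (h m b) (sw (m, b) x _) (conj xb xm)).
by rewrite mulgA mulVg mul1g.
Qed.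

End gluing.

Theorem mainTheorem1 (X : topologicalType) (G : group_sheaf X)
    (Psi : H1 G [set: X]) (U : open_cover [set: X]) :
  (forall n : cover_index U,
     H1_restrict (cover_open U n) Psi = H1_one G (cover_open U n)) ->
  exists Phi : H1_cover G U, H1_class Phi = Psi.
Proof.
have [[V F] ->] := quotient_ind Psi; have [f ->] := quotient_ind F.
rewrite -/(H1_cocycle f) -/(H1_class _) => loc.
have [n|g gf] := @cocycle_of_local_coboundaries X G V U f; last by exists (H1_cocycle g).
apply: (H1_class_eq_one _ (cover_open U n)).
by rewrite -H1_cover_restrictE -H1_restrictE.
Qed.
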